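(* The logic $\mathcal{DHMSH}$ is complete with respect to the variety $\mathbb{DHMSH}$ of dually hemimorphic semi-Heyting algebras; that is, for every set of formulas $\Gamma\cup\{\phi\}$, $\Gamma\vdash_{\mathcal{DHMSH}}\phi$ if and only if $\Gamma\models_{\mathbb{DHMSH}}\phi$.
   Context: Language: $\langle\vee,\wedge,\to,\sim,\bot,\top\rangle$ of arities $2,2,2,1,0,0$; formulas are built over a countably infinite set of propositional variables. The abbreviation $\alpha\to_H\beta$ stands for $\alpha\to(\alpha\wedge\beta)$. The logic $\mathcal{DHMSH}$ is the Hilbert-style logic with axiom schemes: (A1) $\alpha\to_H(\alpha\vee\beta)$; (A2) $\beta\to_H(\alpha\vee\beta)$; (A3) $(\alpha\to_H\gamma)\to_H[(\beta\to_H\gamma)\to_H((\alpha\vee\beta)\to_H\gamma)]$; (A4) $(\alpha\wedge\beta)\to_H\alpha$; (A5) $(\gamma\to_H\alpha)\to_H[(\gamma\to_H\beta)\to_H(\gamma\to_H(\alpha\wedge\beta))]$; (A6) $\top$; (A7) $\bot\to_H\alpha$; (A8) $((\alpha\wedge\beta)\to_H\gamma)\to_H(\alpha\to_H(\beta\to_H\gamma))$; (A9) $(\alpha\to_H(\beta\to_H\gamma))\to_H((\alpha\wedge\beta)\to_H\gamma)$; (A10) $(\alpha\to_H\beta)\to_H((\beta\to_H\alpha)\to_H((\alpha\to\gamma)\to_H(\beta\to\gamma)))$; (A11) $(\alpha\to_H\beta)\to_H((\beta\to_H\alpha)\to_H((\gamma\to\beta)\to_H(\gamma\to\alpha)))$;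 (A12) $\top\to_H{\sim}\bot$; (A13) ${\sim}\top\to_H\bot$; (A14) ${\sim}(\alpha\wedge\beta)\to_H({\sim}\alpha\vee{\sim}\beta)$; and rules (SMP): from $\phi$ and $\phi\to_H\gamma$ deduce $\gamma$; (SCP): from $\phi\to_H\gamma$ deduce ${\sim}\gamma\to_H{\sim}\phi$. $\Gamma\vdash\phi$ means that $\phi$ is derivable from axioms and members of $\Gamma$ by these rules (both rules may be applied to any formulas already derived from $\Gamma$). A semi-Heyting algebra is an algebra $\langle L,\vee,\wedge,\to,0,1\rangle$ such that $\langle L,\vee,\wedge,0,1\rangle$ is a lattice with $0$ and $1$, and $x\wedge(x\to y)\approx x\wedge y$, $x\wedge(y\to z)\approx x\wedge[(x\wedge y)\to(x\wedge z)]$, $x\to x\approx1$. A dually hemimorphic semi-Heyting algebra is an algebra $\langle A,\vee,\wedge,\to,{}',0,1\rangle$ such that $\langle A,\vee,\wedge,\to,0,1\rangle$ is a semi-Heyting algebra and $0'\approx1$, $1'\approx0$, $(x\wedge y)'\approx x'\vee y'$. $\mathbb{DHMSH}$ is the variety of all these. Formulas are interpreted in such algebras with $\sim,\bot,\top$ interpreted as ${}',0,1$. $\Gamma\models_{\mathbb{DHMSH}}\phi$ means: for every $\mathbf A\in\mathbb{DHMSH}$ and every homomorphism $h$ from the formula algebra to $\mathbf A$, if $h(\gamma)=1$ for all $\gamma\in\Gamma$ then $h(\phi)=1$. *)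

(* Defs.v *)
From HB Require Import structures.
From mathcomp Require Import all_boot all_order.
From mathcomp Require Import classical_sets.

Set Implicit Arguments.
Unset Strict Implicit.
Unset Printing Implicit Defensive.

Import Order.LTheory.

Declare Scope fml_scope.
Delimit Scope fml_scope with fml.

Inductive fml : Type :=
| Var of nat
| Or of fml & fml
| And of fml & fml
| Imp of fml & fml
| Neg of fml
| Bot
| Top.

Bind Scope fml_scope with fml.

Definition ImpH (a b : fml) : fml := Imp a (And a b).

Notation "\neg a" := (Neg a) (at level 35, right associativity) : fml_scope.
Notation "a \and b" := (And a b) (at level 40, left associativity) : fml_scope.
Notation "a \or b" := (Or a b) (at level 50, left associativity) : fml_scope.
Notation "a ~> b" := (Imp a b) (at level 55, right associativity) : fml_scope.
Notation "a ~>H b" := (ImpH a b) (at level 55, right associativity) : fml_scope.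

Local Open Scope fml_scope.

Inductive dhmsh_axiom : fml -> Prop :=
| A1 a b : dhmsh_axiom (a ~>H (a \or b))
| A2 a b : dhmsh_axiom (b ~>H (a \or b))
| A3 a b c :
    dhmsh_axiom ((a ~>H c) ~>H ((b ~>H c) ~>H ((a \or b) ~>H c)))
| A4 a b : dhmsh_axiom ((a \and b) ~>H a)
| A5 a b c :
    dhmsh_axiom ((c ~>H a) ~>H ((c ~>H b) ~>H (c ~>H (a \and b))))
| A6 : dhmsh_axiom Top
| A7 a : dhmsh_axiom (Bot ~>H a)
| A8 a b c : dhmsh_axiom (((a \and b) ~>H c) ~>H (a ~>H (b ~>H c)))
| A9 a b c : dhmsh_axiom ((a ~>H (b ~>H c)) ~>H ((a \and b) ~>H c))
| A10 a b c :
    dhmsh_axiom ((a ~>H b) ~>H ((b ~>H a) ~>H ((a ~> c) ~>H (b ~> c))))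
| A11 a b c :
    dhmsh_axiom ((a ~>H b) ~>H ((b ~>H a) ~>H ((c ~> b) ~>H (c ~> a))))
| A12 : dhmsh_axiom (Top ~>H \neg Bot)
| A13 : dhmsh_axiom (\neg Top ~>H Bot)
| A14 a b : dhmsh_axiom (\neg (a \and b) ~>H (\neg a \or \neg b)).

Inductive derivable (G : set fml) : fml -> Prop :=
| derivable_hyp p : G p -> derivable G p
| derivable_axiom p : dhmsh_axiom p -> derivable G p
| derivable_SMP p q : derivable G p -> derivable G (p ~>H q) -> derivable G q
| derivable_SCP p q :
    derivable G (p ~>H q) -> derivable G (\neg q ~>H \neg p).

Local Close Scope fml_scope.
Local Open Scope order_scope.

HB.mixin Record isSemiHeyting d T of Order.TBLattice d T := {
  shimp : T -> T -> T;
  meet_shimp : forall x y : T, x `&` shimp x y = x `&` y;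
  meet_shimpI : forall x y z : T,
    x `&` shimp y z = x `&` shimp (x `&` y) (x `&` z);
  shimpxx : forall x : T, shimp x x = \top
}.

#[short(type="semiHeytingType")]
HB.structure Definition SemiHeyting d :=
  { T of Order.TBLattice d T & isSemiHeyting d T }.

HB.mixin Record isDuallyHemimorphic d T of Order.TBLattice d T := {
  dhneg : T -> T;
  dhneg0 : dhneg \bot = \top;
  dhneg1 : dhneg \top = \bot;
  dhnegI : forall x y : T, dhneg (x `&` y) = dhneg x `|` dhneg y
}.

#[short(type="dhmshType")]
HB.structure Definition DHMSH d :=
  { T of SemiHeyting d T & isDuallyHemimorphic d T }.

Record fml_hom d (A : dhmshType d) (h : fml -> A) : Prop := FmlHom {
  fml_homU : forall a b, h (Or a b) = h a `|` h b;
  fml_homI : forall a b, h (And a b) = h a `&` h b;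
  fml_homImp : forall a b, h (Imp a b) = shimp (h a) (h b);
  fml_homN : forall a, h (Neg a) = dhneg (h a);
  fml_hom0 : h Bot = \bot;
  fml_hom1 : h Top = \top
}.

(* [d] is only the display of the order notations of MathComp; the
   decidable equality and choice operator bundled in [dhmshType] exist on every
   type under [mathcomp.classical.boolp], so [A] ranges over the whole variety,
   including the trivial algebra. *)
Definition models (G : set fml) (p : fml) : Prop :=
  forall (d : Order.disp_t) (A : dhmshType d) (h : fml -> A),
    fml_hom h -> (forall g, G g -> h g = \top) -> h p = \top.

(* Main.v *)
Require Import Defs.
From HB Require Import structures.
From mathcomp Require Import all_boot all_order classical_sets.
From mathcomp Require Import boolp generic_quotient.

(** Soundness holds because, in a semi-Heyting algebra, the derived operation
    x =>H y := x -> (x /\ y) is the residual of the meet ([le_shimpH]): each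
    axiom alpha ->H beta then states an inequality between values, and
    A10 and A11 follow from the identity
    u /\ (x -> y) = u /\ ((u /\ x) -> (u /\ y)).

    Completeness is the Lindenbaum-Tarski argument.  Fix G and put a <= b when
    a ->H b is derivable from G.  The delicate point is that this is a preorder
    at all, since none of reflexivity, transitivity and the second projection
    of a conjunction is among the axioms.  As a ->H b abbreviates
    a -> (a /\ b), the congruence axioms A10 and A11 let the antecedent a and
    the consequent a /\ b be replaced separately by equivalent formulas; since
    a -> (a /\ T) is available for every theorem T, this yields first
    reflexivity ([entails_refl]) and then transitivity ([entails_trans]).
    After that, ->H is the residual of the conjunction, and A10 and A11 say
    that -> respects equivalence modulo any formula u ([Imp_congr]); the three
    semi-Heyting identities are instances of that fact.  The rule SCP makes
    negation a congruence, so formulas modulo mutual entailment form a dually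
    hemimorphic semi-Heyting algebra in which exactly the formulas derivable
    from G have value 1 ([fml_class_top]). *)

Set Implicit Arguments.
Unset Strict Implicit.
Unset Printing Implicit Defensive.

Import Order.LTheory.

Local Open Scope quotient_scope.
Local Open Scope fml_scope.

(** * The entailment preorder *)

(** [a] entails [b] when the Heyting-style implication [a ~>H b] is derivable
    from [G]; this is the order of the Lindenbaum algebra of [G]. *)
Definition entails (G : set fml) (a b : fml) : Prop := derivable G (a ~>H b).

Section Entailment.
Context (G : set fml).
Local Notation "a |- b" := (entails G a b) (at level 70).
Implicit Types a b c u : fml.

Lemma derivable_mp2 a b c :
  dhmsh_axiom (a ~>H (b ~>H c)) -> derivable G a -> derivable G b ->
  derivable G c.
Proof.
move=> ax da db.
exact: derivable_SMP db (derivable_SMP da (derivable_axiom G ax)).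
Qed.

Lemma entails_curry a b c : a \and b |- c -> a |- b ~>H c.
Proof. by move=> h; apply: derivable_SMP h (derivable_axiom G (A8 a b c)). Qed.

Lemma entails_uncurry a b c : a |- b ~>H c -> a \and b |- c.
Proof. by move=> h; apply: derivable_SMP h (derivable_axiom G (A9 a b c)). Qed.

Lemma entails_andl a b : a \and b |- a.
Proof. exact/derivable_axiom/A4. Qed.

Lemma derivable_entails a b : derivable G a -> b |- a.
Proof.
by move=> da; apply: derivable_SMP da (entails_curry (entails_andl a b)).
Qed.

Lemma entails_and a b c : c |- a -> c |- b -> c |- a \and b.
Proof. exact/derivable_mp2/A5. Qed.

Lemma derivable_Imp_congl a b c :
  a |- b -> b |- a -> derivable G (a ~> c) -> derivable G (b ~> c).
Proof.
move=> ab ba ac.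
exact: derivable_SMP ac (derivable_mp2 (A10 a b c) ab ba).
Qed.

Lemma derivable_Imp_congr a b c :
  a |- b -> b |- a -> derivable G (c ~> a) -> derivable G (c ~> b).
Proof.
move=> ab ba ca.
exact: derivable_SMP ca (derivable_mp2 (A11 b a c) ba ab).
Qed.

Lemma entails_top a : a |- Top.
Proof. exact/derivable_entails/derivable_axiom/A6. Qed.

(** [a |- Top] unfolds to [a ~> a \and Top], and [a \and Top] is equivalent
    to [a \and a]. *)
Lemma entails_refl a : a |- a.
Proof.
have aT_aa : a \and Top |- a \and a.
  by apply: entails_and; apply: entails_andl.
have aa_aT : a \and a |- a \and Top.
  by apply: entails_and; [apply: entails_andl | apply: entails_top].
exact: derivable_Imp_congr aT_aa aa_aT (entails_top a).
Qed.

Lemma entails_andr a b : a \and b |- b.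
Proof. exact/entails_uncurry/derivable_entails/entails_refl. Qed.

Lemma entails_andC a b : a \and b |- b \and a.
Proof. by apply: entails_and; [apply: entails_andr | apply: entails_andl]. Qed.

Lemma entails_wkl a b c : a |- b -> c \and a |- b.
Proof. by move=> ab; apply/entails_uncurry/derivable_entails. Qed.

(** Replacing [a] by [a'] in [a ~> (a \and b)] takes a rewriting on each side
    of the implication. Inside the consequent it needs [a] on the right of the
    conjunction: before this lemma, an entailment can be weakened by a conjunct
    on the left only ([entails_wkl]). *)
Lemma entails_congl a a' b : a |- a' -> a' |- a -> a |- b -> a' |- b.
Proof.
move=> aa' a'a ab.
have cg c d : c |- d -> b \and c |- b \and d.
  by move=> cd; apply: entails_and; [apply: entails_andl | apply: entails_wkl].
apply: (derivable_Imp_congl aa' a'a).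
apply: (derivable_Imp_congr (entails_andC b a') (entails_andC a' b)).
apply: (derivable_Imp_congr (cg _ _ aa') (cg _ _ a'a)).
exact: (derivable_Imp_congr (entails_andC a b) (entails_andC b a)).
Qed.

Lemma entails_wkr a b c : a |- b -> a \and c |- b.
Proof.
move=> ab.
exact: entails_congl (entails_andC c a) (entails_andC a c) (entails_wkl c ab).
Qed.

Lemma entails_trans b a c : a |- b -> b |- c -> a |- c.
Proof.
move=> ab bc.
have a_ab : a |- a \and b by apply: entails_and => //; apply: entails_refl.
exact: entails_congl (entails_andl a b) a_ab (entails_wkl a bc).
Qed.

Lemma entails_mp2 u a b c : dhmsh_axiom (a ~>H (b ~>H c)) ->
  u |- a -> u |- b -> u |- c.
Proof.
move=> ax ua ub; apply: (entails_trans (entails_and ua ub)).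
exact/entails_uncurry/derivable_axiom.
Qed.

Lemma entails_or a b c : a |- c -> b |- c -> a \or b |- c.
Proof. exact/derivable_mp2/A3. Qed.

Lemma entails_orl a b : a |- a \or b.
Proof. exact/derivable_axiom/A1. Qed.

Lemma entails_orr a b : b |- a \or b.
Proof. exact/derivable_axiom/A2. Qed.

Lemma entails_mp u a b : u |- a -> u |- a ~>H b -> u |- b.
Proof.
move=> ua uab; apply: (entails_trans (entails_and uab ua)).
exact/entails_uncurry/entails_refl.
Qed.

(** Implication respects equivalence modulo any formula [u]. *)
Lemma Imp_congr u a a' b b' :
    u \and a |- a' -> u \and a' |- a -> u \and b |- b' -> u \and b' |- b ->
  u \and (a ~> b) |- (a' ~> b').
Proof.
move=> /entails_curry aa' /entails_curry a'a.
move=> /entails_curry bb' /entails_curry b'b.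
apply: (@entails_mp _ (a' ~> b)).
  exact/entails_uncurry/(entails_mp2 (A10 a a' b)).
exact/entails_wkr/(entails_mp2 (A11 b' b a')).
Qed.

Lemma entails_Imp_refl a b : b |- (a ~> a).
Proof.
apply: derivable_entails; apply: (@derivable_Imp_congr (a \and a)).
- exact: entails_andl.
- by apply: entails_and; apply: entails_refl.
- exact: entails_refl.
Qed.

(** The two halves of the semi-Heyting identity a /\ (a -> b) = a /\ b. The
    first replaces [b] by [a \and b] in the consequent, modulo [a]; the second
    undoes this in the Heyting-style implication, again modulo [a]. *)
Lemma and_Imp_entails a b : a \and (a ~> b) |- a \and b.
Proof.
apply: entails_and; first exact: entails_andl.
apply: entails_mp (entails_andl _ _) _; apply: Imp_congr.
- exact: entails_andr.
- exact: entails_andr.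
- exact: entails_refl.
- exact/entails_wkl/entails_andr.
Qed.

Lemma entails_and_Imp a b : a \and b |- a \and (a ~> b).
Proof.
apply: entails_and; first exact: entails_andl.
have ab_Hab : a \and b |- a \and (a ~>H b).
  apply: entails_and; first exact: entails_andl.
  exact/entails_curry/entails_wkr/entails_andr.
apply: entails_trans ab_Hab _; apply: Imp_congr.
- exact: entails_andr.
- exact: entails_andr.
- exact/entails_wkl/entails_andr.
- exact: entails_refl.
Qed.

(** Modulo [a], every [b] is equivalent to [a \and b]. *)
Lemma and_Imp_relativize a b c :
  a \and (b ~> c) |- a \and ((a \and b) ~> (a \and c)).
Proof.
apply: entails_and; first exact: entails_andl.
by apply: Imp_congr;
  first [exact: entails_refl | exact/entails_wkl/entails_andr].
Qed.

Lemma and_Imp_unrelativize a b c :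
  a \and ((a \and b) ~> (a \and c)) |- a \and (b ~> c).
Proof.
apply: entails_and; first exact: entails_andl.
by apply: Imp_congr;
  first [exact: entails_refl | exact/entails_wkl/entails_andr].
Qed.

End Entailment.

(** * The Lindenbaum algebra *)

HB.instance Definition _ := gen_eqMixin fml.
HB.instance Definition _ := gen_choiceMixin fml.

(** Mutual entailment from [G]. *)
Definition equivalent (G : set fml) : rel fml :=
  fun a b => `[< entails G a b /\ entails G b a >].

Lemma equivalent_refl G : reflexive (equivalent G).
Proof. by move=> a; apply/asboolP; split; apply: entails_refl. Qed.

Lemma equivalent_sym G : symmetric (equivalent G).
Proof. by move=> a b; apply/asboolP/asboolP => -[]. Qed.

Lemma equivalent_trans G : transitive (equivalent G).
Proof.
move=> b a c /asboolP[ab ba] /asboolP[bc cb].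
by apply/asboolP; split;
  [exact: entails_trans ab bc | exact: entails_trans cb ba].
Qed.

Canonical equivalent_equiv G := EquivRel (equivalent G)
  (@equivalent_refl G) (@equivalent_sym G) (@equivalent_trans G).

(** Formulas modulo mutual entailment from [G]. *)
Definition lindenbaum (G : set fml) : Type := {eq_quot (equivalent G)}.

HB.instance Definition _ G := Choice.on (lindenbaum G).

Section LindenbaumOps.
Context (G : set fml).
Local Notation L := (lindenbaum G).
Local Notation "a |- b" := (entails G a b) (at level 70).
Implicit Types (a b : fml) (x y z : L).

(** The class of a formula, and a chosen formula in a class. *)
Definition fml_class a : L := \pi_({eq_quot (equivalent G)}) a.
Definition fml_repr x : fml := repr (x : {eq_quot (equivalent G)}).

Lemma fml_reprK x : fml_class (fml_repr x) = x.
Proof. exact: reprK. Qed.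

Lemma fml_class_eq a b : fml_class a = fml_class b <-> a |- b /\ b |- a.
Proof.
split=> [/eqmodP/asboolP //|ab].
by apply/eqmodP/asboolP.
Qed.

Lemma fml_class_repr a :
  fml_repr (fml_class a) |- a /\ a |- fml_repr (fml_class a).
Proof. by apply/fml_class_eq; rewrite fml_reprK. Qed.

Lemma fml_classW (P : L -> Prop) : (forall a, P (fml_class a)) -> forall x, P x.
Proof. by move=> h x; rewrite -(fml_reprK x). Qed.

(** The order and the operations of the Lindenbaum algebra are defined on
    chosen representatives; the lemmas [lle_class] to [lneg_class] show that
    the choice does not matter. *)
Definition lle x y : bool := `[< fml_repr x |- fml_repr y >].
Definition lmeet x y : L := fml_class (fml_repr x \and fml_repr y).
Definition ljoin x y : L := fml_class (fml_repr x \or fml_repr y).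
Definition limp x y : L := fml_class (fml_repr x ~> fml_repr y).
Definition lneg x : L := fml_class (\neg (fml_repr x)).

Lemma lle_class a b : lle (fml_class a) (fml_class b) <-> a |- b.
Proof.
have [ra ar] := fml_class_repr a; have [rb br] := fml_class_repr b.
split=> [/asboolP ab|ab]; last apply/asboolP.
  exact: entails_trans ar (entails_trans ab rb).
exact: entails_trans ra (entails_trans ab br).
Qed.

Lemma lle_refl : reflexive lle.
Proof. by move=> x; apply/asboolP/entails_refl. Qed.

Lemma lle_trans : transitive lle.
Proof.
by move=> y x z /asboolP xy /asboolP yz; apply/asboolP/(entails_trans xy yz).
Qed.

Lemma lle_anti : antisymmetric lle.
Proof.
move=> x y /andP[/asboolP xy /asboolP yx].
by rewrite -(fml_reprK x) -(fml_reprK y); apply/fml_class_eq.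
Qed.

Lemma lmeet_class a b :
  lmeet (fml_class a) (fml_class b) = fml_class (a \and b).
Proof.
have [ra ar] := fml_class_repr a; have [rb br] := fml_class_repr b.
apply/fml_class_eq; split; apply: entails_and;
  by [apply: entails_wkr | apply: entails_wkl].
Qed.

Lemma ljoin_class a b : ljoin (fml_class a) (fml_class b) = fml_class (a \or b).
Proof.
have [ra ar] := fml_class_repr a; have [rb br] := fml_class_repr b.
apply/fml_class_eq; split; apply: entails_or;
  by [apply: entails_trans (entails_orl _ _ _)
     |apply: entails_trans (entails_orr _ _ _)].
Qed.

Lemma limp_class a b : limp (fml_class a) (fml_class b) = fml_class (a ~> b).
Proof.
have [ra ar] := fml_class_repr a; have [rb br] := fml_class_repr b.
have Imp_cg c c' d d' : c |- c' -> c' |- c -> d |- d' -> d' |- d ->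
    (c ~> d) |- (c' ~> d').
  move=> *; apply: (entails_trans (b := Top \and (c ~> d))).
    by apply: entails_and; [apply: entails_top | apply: entails_refl].
  by apply: Imp_congr; apply: entails_wkl.
by apply/fml_class_eq; split; apply: Imp_cg.
Qed.

Lemma lneg_class a : lneg (fml_class a) = fml_class (\neg a).
Proof.
have [ra ar] := fml_class_repr a.
by apply/fml_class_eq; split; apply: derivable_SCP.
Qed.

Lemma lle_meet x y z : lle x (lmeet y z) = lle x y && lle x z.
Proof.
elim/fml_classW: x => a; elim/fml_classW: y => b; elim/fml_classW: z => c.
rewrite lmeet_class; apply/idP/andP => [/lle_class abc|].
  split; apply/lle_class; apply: (entails_trans abc).
    exact: entails_andl.
  exact: entails_andr.
by case=> /lle_class ab /lle_class ac; apply/lle_class/entails_and.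
Qed.

Lemma lle_join x y z : lle (ljoin x y) z = lle x z && lle y z.
Proof.
elim/fml_classW: x => a; elim/fml_classW: y => b; elim/fml_classW: z => c.
rewrite ljoin_class; apply/idP/andP => [/lle_class abc|].
  split; apply/lle_class; apply: entails_trans abc.
    exact: entails_orl.
  exact: entails_orr.
by case=> /lle_class ac /lle_class bc; apply/lle_class/entails_or.
Qed.

Lemma lle_bot x : lle (fml_class Bot) x.
Proof. by elim/fml_classW: x => a; apply/lle_class/derivable_axiom/A7. Qed.

Lemma lle_top x : lle x (fml_class Top).
Proof. by elim/fml_classW: x => a; apply/lle_class/entails_top. Qed.

Lemma lmeet_limp x y : lmeet x (limp x y) = lmeet x y.
Proof.
elim/fml_classW: x => a; elim/fml_classW: y => b.
rewrite limp_class !lmeet_class; apply/fml_class_eq.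
by split; [apply: and_Imp_entails | apply: entails_and_Imp].
Qed.

Lemma lmeet_limpI x y z :
  lmeet x (limp y z) = lmeet x (limp (lmeet x y) (lmeet x z)).
Proof.
elim/fml_classW: x => a; elim/fml_classW: y => b; elim/fml_classW: z => c.
(* [limp b c] is itself convertible to a class, so that an unguided rewriting
   with [lmeet_class] would unfold it. *)
rewrite limp_class (lmeet_class a b) (lmeet_class a c) limp_class !lmeet_class.
apply/fml_class_eq.
by split; [apply: and_Imp_relativize | apply: and_Imp_unrelativize].
Qed.

Lemma limpxx x : limp x x = fml_class Top.
Proof.
elim/fml_classW: x => a; rewrite limp_class; apply/fml_class_eq.
by split; [apply: entails_top | apply: entails_Imp_refl].
Qed.

Lemma lneg_bot : lneg (fml_class Bot) = fml_class Top.
Proof.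
rewrite lneg_class; apply/fml_class_eq.
by split; [apply: entails_top | apply/derivable_axiom/A12].
Qed.

Lemma lneg_top : lneg (fml_class Top) = fml_class Bot.
Proof.
rewrite lneg_class; apply/fml_class_eq.
by split; apply: derivable_axiom; [apply: A13 | apply: A7].
Qed.

Lemma lneg_meet x y : lneg (lmeet x y) = ljoin (lneg x) (lneg y).
Proof.
elim/fml_classW: x => a; elim/fml_classW: y => b.
rewrite lmeet_class !lneg_class ljoin_class; apply/fml_class_eq.
split; first exact/derivable_axiom/A14.
by apply: entails_or; apply: derivable_SCP;
  [apply: entails_andl | apply: entails_andr].
Qed.

End LindenbaumOps.

Fact lindenbaum_display : Order.disp_t. Proof. exact: Order.Disp tt tt. Qed.

HB.instance Definition _ G := Order.Le_isPOrder.Build lindenbaum_display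
  (lindenbaum G) (@lle_refl G) (@lle_anti G) (@lle_trans G).
HB.instance Definition _ G := Order.POrder_MeetJoin_isLattice.Build
  lindenbaum_display (lindenbaum G) (@lle_meet G) (@lle_join G).
HB.instance Definition _ G := Order.hasBottom.Build
  lindenbaum_display (lindenbaum G) (@lle_bot G).
HB.instance Definition _ G := Order.hasTop.Build
  lindenbaum_display (lindenbaum G) (@lle_top G).
HB.instance Definition _ G := isSemiHeyting.Build
  lindenbaum_display (lindenbaum G)
  (@lmeet_limp G) (@lmeet_limpI G) (@limpxx G).
HB.instance Definition _ G := isDuallyHemimorphic.Build
  lindenbaum_display (lindenbaum G)
  (@lneg_bot G) (@lneg_top G) (@lneg_meet G).

(** The canonical valuation of the formulas in their Lindenbaum algebra. *)
Lemma fml_class_hom G : fml_hom (@fml_class G : fml -> lindenbaum G).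
Proof.
split=> //.
- by move=> a b; rewrite -ljoin_class.
- by move=> a b; rewrite -lmeet_class.
- by move=> a b; rewrite -limp_class.
- by move=> a; rewrite -lneg_class.
Qed.

Lemma fml_class_top G a :
  (fml_class G a = (\top : lindenbaum G)%O) <-> derivable G a.
Proof.
split=> [/fml_class_eq[_ Ta]|da].
  exact: derivable_SMP (derivable_axiom G A6) Ta.
by apply/fml_class_eq; split; [apply: entails_top | apply: derivable_entails].
Qed.

(** * Soundness *)

Local Close Scope fml_scope.
Local Open Scope order_scope.

Section SemiHeytingTheory.
Context (d : Order.disp_t) (A : semiHeytingType d).
Implicit Types x y z u : A.

(** The value of the Heyting-style implication. *)
Definition shimpH x y : A := shimp x (x `&` y).

Lemma le_shimpH u x y : (u <= shimpH x y) = (u `&` x <= y).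
Proof.
apply/idP/idP => [ux|uxy].
  rewrite meetC; apply: le_trans (leI2 (lexx x) ux) _.
  by rewrite /shimpH meet_shimp meetA meetxx leIr.
rewrite leEmeet /shimpH meet_shimpI meetA.
by move: uxy; rewrite leEmeet => /eqP->; rewrite shimpxx meetx1.
Qed.

Lemma shimpH_mp x y : shimpH x y `&` x <= y.
Proof. by rewrite -le_shimpH. Qed.

Lemma shimpH_top x y : (shimpH x y = \top) <-> x <= y.
Proof.
by rewrite -[x in _ <-> x <= _]meet1x -le_shimpH le1x; split=> /eqP.
Qed.

Lemma shimp_congl u x y z :
  u `&` x = u `&` y -> u `&` shimp x z = u `&` shimp y z.
Proof. by move=> uxy; rewrite meet_shimpI uxy -meet_shimpI. Qed.

Lemma shimp_congr u x y z :
  u `&` x = u `&` y -> u `&` shimp z x = u `&` shimp z y.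
Proof. by move=> uxy; rewrite meet_shimpI uxy -meet_shimpI. Qed.

(** Below x =>H y and y =>H x, the elements x and y agree; this is what A10 and
    A11 need in order to use [shimp_congl] and [shimp_congr]. *)
Lemma meet_shimpH_eq x y :
  shimpH x y `&` shimpH y x `&` x = shimpH x y `&` shimpH y x `&` y.
Proof.
set u := _ `&` shimpH y x.
have ux : u `&` x <= y by rewrite -le_shimpH; apply: leIl.
have uy : u `&` y <= x by rewrite -le_shimpH; apply: leIr.
by clearbody u; apply: le_anti; rewrite !lexI !leIl ux uy.
Qed.

End SemiHeytingTheory.

Section Soundness.
Context (d : Order.disp_t) (A : dhmshType d) (h : fml -> A).
Hypothesis hh : fml_hom h.

Lemma fml_homH a b : h (ImpH a b) = shimpH (h a) (h b).
Proof. by rewrite /ImpH (fml_homImp hh) (fml_homI hh). Qed.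

Lemma fml_hom_axiom a : dhmsh_axiom a -> h a = \top.
Proof.
pose E := (fml_homH, fml_homU hh, fml_homI hh, fml_homImp hh, fml_homN hh,
           fml_hom0 hh, fml_hom1 hh).
case=> *; rewrite !E //; apply/shimpH_top; rewrite ?le_shimpH.
- exact: leUl.
- exact: leUr.
- rewrite meetC -le_shimpH leUx !le_shimpH ![_ `&` (_ `&` _)]meetC.
  apply/andP; split; apply: le_trans (shimpH_mp _ _); apply: leI2 => //.
    exact: leIl.
  exact: leIr.
- exact: leIl.
- rewrite lexI.
  apply/andP; split; apply: le_trans (shimpH_mp _ _); apply: leI2 => //.
    exact: leIl.
  exact: leIr.
- exact: le0x.
- by rewrite -meetA -le_shimpH.
- by rewrite meetA -!le_shimpH.
- by rewrite (shimp_congl _ (meet_shimpH_eq _ _)) leIr.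
- by rewrite -(shimp_congr _ (meet_shimpH_eq _ _)) leIr.
- by rewrite dhneg0.
- by rewrite dhneg1.
- by rewrite dhnegI.
Qed.

(** Soundness with respect to a single algebra. *)
Lemma derivable_hom_top (G : set fml) a :
  (forall g, G g -> h g = \top) -> derivable G a -> h a = \top.
Proof.
move=> hG; elim=> [b /hG//|b /fml_hom_axiom//|b c _ hb _|b c _].
  by rewrite fml_homH => /shimpH_top; rewrite hb ; rewrite le1x => /eqP.
rewrite !fml_homH !(fml_homN hh) => /shimpH_top bc; apply/shimpH_top.
by move: bc; rewrite leEmeet => /eqP <-; rewrite dhnegI leUr.
Qed.

End Soundness.

Theorem theorem4p5 (G : set fml) (p : fml) : derivable G p <-> models G p.
Proof.
split=> [dp d A h hh hG|modp]; first exact: derivable_hom_top hG dp.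
apply/fml_class_top/(modp _ (lindenbaum G)); first exact: fml_class_hom.
by move=> g Gg; apply/fml_class_top/derivable_hyp.
Qed.
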